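(* Let $A, B \subset \mathbb{R}^n$ be set-germs at $0 \in \mathbb{R}^n$ such that $0 \in \overline{A} \cap \overline{B}$, and let $h : (\mathbb{R}^n,0) \to (\mathbb{R}^n,0)$ be a bi-Lipschitz homeomorphism. Suppose that $A$, $B$, $h(A)$, $h(B)$ satisfy condition $(SSP)$. Then $A$ and $B$ are transverse at $0\in \mathbb{R}^n$ if and only if $h(A)$ and $h(B)$ are transverse at $h(0)=0\in \mathbb{R}^n$.
   Context: For a set-germ $A$ at $0\in\mathbb{R}^n$ with $0\in\overline{A}$, the direction set of $A$ at $0$ is $$D(A) := \{a \in S^{n-1} \mid \exists \{x_i\} \subset A\setminus\{0\},\ x_i \to 0,\ \text{s.t. } \tfrac{x_i}{\|x_i\|}\to a,\ i\to\infty\},$$ where $S^{n-1}$ is the unit sphere centred at $0\in\mathbb{R}^n$. The real tangent cone of $A$ at $0$ is $LD(A) := \{ta \in \mathbb{R}^n\mid a \in D(A),\ t\ge 0\}$. A set-germ $A$ at $0$ with $0\in\overline{A}$ satisfies condition $(SSP)$ (sequence selection property) if for any sequence of points $\{a_m\}$ of $\mathbb{R}^n$ tending to $0$ such that $\lim_{m\to\infty} \frac{a_m}{\|a_m\|}\in D(A)$, there is a sequence of points $\{b_m\}\subset A$ such that $\|a_m-b_m\|\ll\|a_m\|, \|b_m\|$, i.e. $\lim_{m\to\infty}\frac{\|a_m-b_m\|}{\|a_m\|}=0$. Set-germs $A,B\subset\mathbb{R}^n$ at $0$ with $0\in\overline{A}\cap\overline{B}$ are called transverse at $0\in\mathbb{R}^n$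 if and only if $$\dim LD(A)+\dim LD(B)-\dim(LD(A)\cap LD(B)) = n.$$ A bi-Lipschitz homeomorphism is a homeomorphism which is Lipschitz with Lipschitz inverse; here it is a germ at $0$ with $h(0)=0$. $\dim$ denotes dimension; the source does not specify which notion of dimension is used. *)

(* Defs.v *)
From HB Require Import structures.
From mathcomp Require Import all_boot all_order all_algebra.
From mathcomp Require Import all_classical all_reals all_analysis.
Set Implicit Arguments.
Unset Strict Implicit.
Unset Printing Implicit Defensive.
Import Order.TTheory GRing.Theory Num.Theory.
Import numFieldNormedType.Exports.
Local Open Scope classical_set_scope.
Local Open Scope ring_scope.

(* The norm `|x| on 'rV[R]_n is the sup norm; the unit sphere, diameters and
   Lipschitz constants below use the Euclidean norm. Both norms induce the
   canonical topology of 'rV[R]_n, which is the one used for convergence. *)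
Definition enorm (R : realType) (n : nat) (x : 'rV[R]_n) : R :=
  Num.sqrt (\sum_(i < n) x 0 i ^+ 2).

Definition normalize (R : realType) (n : nat) (x : 'rV[R]_n) : 'rV[R]_n :=
  (enorm x)^-1 *: x.

(* A set-germ at 0 is given by a representative A : set 'rV[R]_n. When 0 is in
   the closure of A, the notions below only depend on the germ of A at 0. *)
Definition direction_set (R : realType) (n : nat) (A : set 'rV[R]_n) :
    set 'rV[R]_n :=
  [set a | enorm a = 1 /\
    exists x : nat -> 'rV[R]_n,
      [/\ forall i, (A `\ 0) (x i),
          x @ \oo --> (0 : 'rV[R]_n) &
          (fun i => normalize (x i)) @ \oo --> a]].

Definition tangent_cone (R : realType) (n : nat) (A : set 'rV[R]_n) :
    set 'rV[R]_n :=
  [set y | exists t a, [/\ 0 <= t, direction_set A a & y = t *: a]].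

Definition ssp (R : realType) (n : nat) (A : set 'rV[R]_n) : Prop :=
  forall a : nat -> 'rV[R]_n,
    (forall m, a m != 0) ->
    a @ \oo --> (0 : 'rV[R]_n) ->
    (exists2 v, direction_set A v & (fun m => normalize (a m)) @ \oo --> v) ->
    exists2 b : nat -> 'rV[R]_n,
      (forall m, A (b m)) &
      (fun m => enorm (a m - b m) / enorm (a m)) @ \oo --> (0 : R).

Definition elipschitz (R : realType) (n : nat) (U : set 'rV[R]_n)
    (f : 'rV[R]_n -> 'rV[R]_n) : Prop :=
  exists L : R, forall x y, U x -> U y ->
    enorm (f x - f y) <= L * enorm (x - y).

(* (U, V, h) represents the germ of a bi-Lipschitz homeomorphism
   (R^n, 0) -> (R^n, 0); the values of h outside U are irrelevant. *)
Definition bilipschitz_germ (R : realType) (n : nat) (U V : set 'rV[R]_n)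
    (h : 'rV[R]_n -> 'rV[R]_n) : Prop :=
  [/\ open_nbhs (0 : 'rV[R]_n) U, open_nbhs (0 : 'rV[R]_n) V, h 0 = 0 &
      exists g : 'rV[R]_n -> 'rV[R]_n,
        [/\ forall x, U x -> V (h x) /\ g (h x) = x,
            forall y, V y -> U (g y) /\ h (g y) = y,
            elipschitz U h & elipschitz V g]].

Definition germ_image (R : realType) (n : nat) (U : set 'rV[R]_n)
    (h : 'rV[R]_n -> 'rV[R]_n) (A : set 'rV[R]_n) : set 'rV[R]_n :=
  h @` (A `&` U).

Section CoveringDimension.
Context {T : topologicalType}.
Implicit Types (X : set T) (C : set (set T)) (k : nat).

Definition rel_open_cover X C : Prop :=
  (forall W, C W -> exists2 O, open O & W = X `&` O) /\
  \bigcup_(W in C) W = X.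

Definition refines C C' : Prop :=
  forall W, C W -> exists2 W', C' W' & W `<=` W'.

(* no point lies in more than k members of C *)
Definition order_le C k : Prop :=
  forall F : 'I_k.+1 -> set T, injective F -> (forall i, C (F i)) ->
    \bigcap_i F i = set0.

Definition covering_order_le X k : Prop :=
  forall C, rel_open_cover X C ->
    exists C', [/\ rel_open_cover X C', refines C' C & order_le C' k].

(* Lebesgue covering dimension; order k means dimension k - 1, so that the
   empty set has dimension -1. *)
Definition covering_dim (R : realType) X : \bar R :=
  ereal_inf [set (k%:R - 1)%:E | k in covering_order_le X].

End CoveringDimension.

Section HausdorffDimension.
Context {R : realType} {n : nat}.
Implicit Types (X : set 'rV[R]_n) (s delta : R).
Local Open Scope ereal_scope.

(* 0 is added so that the diameter of the empty set is 0 rather than -oo *)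
Definition diam X : \bar R :=
  ereal_sup (0 |` [set (enorm (x - y))%:E | x in X & y in X]).

Definition hausdorff_pre s delta X : \bar R :=
  ereal_inf [set \sum_(0 <= k <oo) diam (F k) `^ s |
    F in [set F : nat -> set 'rV[R]_n |
      X `<=` \bigcup_k F k /\ forall k, diam (F k) <= delta%:E]].

Definition hausdorff_measure s X : \bar R :=
  ereal_sup [set hausdorff_pre s delta X | delta in [set d : R | (0 < d)%R]].

(* Leaving out s = 0, where 0 `^ 0 = 1 would count empty pieces of a cover,
   does not change the infimum. *)
Definition hausdorff_dim X : \bar R :=
  ereal_inf [set s%:E |
    s in [set s : R | (0 < s)%R /\ hausdorff_measure s X = 0]].

End HausdorffDimension.

(* Tangent cones of arbitrary set-germs are arbitrary closed cones, for which
   the topological and the metric notion of dimension may differ. *)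
Variant dimension_notion := Covering | Hausdorff.

Definition dimension (R : realType) (n : nat) (d : dimension_notion)
    (X : set 'rV[R]_n) : \bar R :=
  match d with
  | Covering => covering_dim R X
  | Hausdorff => hausdorff_dim X
  end.

Definition transverse (R : realType) (n : nat) (d : dimension_notion)
    (A B : set 'rV[R]_n) : Prop :=
  (dimension d (tangent_cone A) + dimension d (tangent_cone B)
   - dimension d (tangent_cone A `&` tangent_cone B) = n%:R%:E)%E.

(* Main.v *)
Require Import Defs.
From mathcomp Require Import all_boot all_order all_algebra.
From mathcomp Require Import all_classical all_reals all_analysis.
Import Order.TTheory GRing.Theory Num.Theory.
Import numFieldNormedType.Exports.
Local Open Scope classical_set_scope.
Local Open Scope ring_scope.

(** Blowing up the germ h at the origin gives a map that acts on tangent cones.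
    The rescaled maps h_m(x) = (m + 1) h(x / (m + 1)) are uniformly bi-Lipschitz,
    so that each sequence m |-> h_m(x) is eventually bounded, and its limit
    phi(x) along one ultrafilter on nat, fixed once and for all, exists by
    compactness of balls. Using an ultrafilter instead of a convergent
    subsequence gives all values phi(x) at once, with no diagonal extraction.
    Pointwise limits keep Lipschitz bounds, and the limit psi of the rescaled
    inverses inverts phi ([blowup_limK]), so phi is a bi-Lipschitz bijection of
    the whole space.

    The sequence selection property enters in [blowup_lim_direction]: a tangent
    direction a of A is approximated by the points t a / (m + 1) of its ray,
    which (SSP) moves into A with an error of smaller order. The Lipschitz bound
    for h keeps the error of smaller order, so the image points, rescaled by
    m + 1, still accumulate at phi(t a), which is therefore tangent to h(A). The
    same argument for the inverse germ and (SSP) for h(A) yields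
    LD(h(A)) = phi(LD(A)) ([bilipschitz_germ_tangent]).

    The map phi depends on h only, so the same phi serves A and B, and since it
    is injective it carries LD(A) `&` LD(B) onto LD(h(A)) `&` LD(h(B)). A
    bi-Lipschitz bijection preserves covering dimension, being a homeomorphism,
    and Hausdorff dimension ([dimension_image]): the three dimensions in the
    transversality equation are the same for A, B and for h(A), h(B). *)

Set Implicit Arguments.
Unset Strict Implicit.
Unset Printing Implicit Defensive.

(** * Euclidean norm, normalization and tangent cones *)

Lemma enorm0 (R : realType) n : enorm (0 : 'rV[R]_n) = 0.
Proof.
by rewrite /enorm big1 ?sqrtr0// => i _; rewrite mxE expr0n.
Qed.

Lemma enorm_ge0 (R : realType) n (x : 'rV[R]_n) : 0 <= enorm x.
Proof. exact: sqrtr_ge0. Qed.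

Lemma enormZ (R : realType) n (t : R) (x : 'rV[R]_n) :
  enorm (t *: x) = `|t| * enorm x.
Proof.
rewrite /enorm -sqrtr_sqr -sqrtrM ?sqr_ge0// mulr_sumr.
by congr Num.sqrt; apply: eq_bigr => i _; rewrite mxE exprMn.
Qed.

Lemma coord_le_norm (R : realType) n (x : 'rV[R]_n) i : `|x 0 i| <= `|x|.
Proof.
rewrite [leRHS]mx_normrE.
exact: (@le_bigmax _ _ _ 0 (fun ij : 'I_1 * 'I_n => `|x ij.1 ij.2|) (0, i)).
Qed.

Lemma norm_le_enorm (R : realType) n (x : 'rV[R]_n) : `|x| <= enorm x.
Proof.
rewrite [leLHS]mx_normrE; apply/bigmax_leP; split; first exact: enorm_ge0.
move=> [i j] _ /=; rewrite ord1 -sqrtr_sqr ler_wsqrtr//.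
by rewrite (bigD1 j)//= lerDl sumr_ge0// => k _; rewrite sqr_ge0.
Qed.

Lemma enorm_le_norm (R : realType) n (x : 'rV[R]_n) :
  enorm x <= n%:R * `|x|.
Proof.
rewrite -[leRHS]ger0_norm ?mulr_ge0// -sqrtr_sqr ler_wsqrtr//.
apply: (@le_trans _ _ (\sum_(i < n) `|x| ^+ 2)).
  apply: ler_sum => i _; rewrite -real_normK ?num_real//.
  by rewrite lerXn2r ?nnegrE// coord_le_norm.
rewrite sumr_const card_ord -[leLHS]mulr_natl exprMn ler_wpM2r ?sqr_ge0//.
by rewrite -natrX ler_nat; case: (n) => // k; rewrite leq_pmulr.
Qed.

Lemma enorm_gt0 (R : realType) n (x : 'rV[R]_n) : (0 < enorm x) = (x != 0).
Proof.
apply/idP/idP => [|x0]; last first.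
  by rewrite (lt_le_trans _ (norm_le_enorm x)) ?normr_gt0.
by apply: contraTneq => ->; rewrite enorm0 ltxx.
Qed.

Lemma enorm_continuous (R : realType) n : continuous (@enorm R n).
Proof.
move=> x.
apply: (@continuous_comp _ _ _ (fun y : 'rV[R]_n => \sum_(i < n) y 0 i ^+ 2)).
  apply: continuous_big; first by move=> a; exact: add_continuous.
  move=> i _ y.
  apply: (@continuous_comp _ _ _ (fun z : 'rV[R]_n => z 0 i)
            (fun r : R => r ^+ 2)).
    exact: coord_continuous.
  exact: (@exprn_continuous R 2 _).
exact: sqrt_continuous.
Qed.

Lemma normalizeZ (R : realType) n (t : R) (x : 'rV[R]_n) : 0 < t ->
  normalize (t *: x) = normalize x.
Proof.
move=> t0; rewrite /normalize enormZ gtr0_norm// scalerA invfM mulrAC.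
by rewrite mulVf ?gt_eqF// mul1r.
Qed.

Lemma enorm_normalize (R : realType) n (x : 'rV[R]_n) : x != 0 ->
  enorm (normalize x) = 1.
Proof.
rewrite -enorm_gt0 => x0.
by rewrite enormZ ger0_norm ?invr_ge0 ?ltW// mulVf// gt_eqF.
Qed.

Lemma scale_normalize (R : realType) n (x : 'rV[R]_n) :
  enorm x *: normalize x = x.
Proof.
have [->|] := eqVneq x 0; first by rewrite enorm0 scale0r.
by rewrite -enorm_gt0 => x0; rewrite scalerA divff ?gt_eqF// scale1r.
Qed.

Lemma normalize_cvg (R : realType) n (u : nat -> 'rV[R]_n) (x : 'rV[R]_n) :
  x != 0 -> u @ \oo --> x -> (fun m => normalize (u m)) @ \oo --> normalize x.
Proof.
rewrite -enorm_gt0 => x0 ux; apply: cvgZ => //; apply: cvgV; first by rewrite gt_eqF.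
exact: (continuous_cvg _ (@enorm_continuous R n x) ux).
Qed.

(** Normalization ignores the positive factors t and is continuous at y, so any
    choice of approximations for e = 1 / (k + 1) yields a sequence whose
    directions tend to that of y. *)
Lemma tangent_cone_approx (R : realType) n (S : set 'rV[R]_n) (y : 'rV[R]_n) :
  y != 0 ->
  (forall e : R, 0 < e ->
     exists t x, [/\ 0 < t, S x, `|x| < e & `|t *: x - y| < e]) ->
  tangent_cone S y.
Proof.
move=> y0 H; have ny0 : 0 < `|y| by rewrite normr_gt0.
have /choice[tx txP] (k : nat) : exists tx : R * 'rV[R]_n,
    [/\ 0 < tx.1, S tx.2, tx.2 != 0, `|tx.2| < k.+1%:R^-1 &
        `|tx.1 *: tx.2 - y| < k.+1%:R^-1].
  (* the bound by the norm of y keeps the chosen point away from 0 *)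
  have [|t [x [t0 Sx xe txe]]] := H (Num.min k.+1%:R^-1 `|y|).
    by rewrite lt_min invr_gt0 ltr0n ny0.
  exists (t, x) => /=; rewrite !lt_min in xe txe.
  case/andP: xe => -> _; case/andP: txe => -> txy; split => //.
  by apply: contraTneq txy => ->; rewrite scaler0 sub0r normrN ltxx.
have small (u : nat -> 'rV[R]_n) :
    (forall k, `|u k| < k.+1%:R^-1) -> u @ \oo --> (0 : 'rV[R]_n).
  move=> uk; apply/cvgr0Pnorm_lt => e e0; near=> k.
  apply: (lt_trans (uk k)); near: k.
  exact: (near_infty_natSinv_lt (PosNum e0)).
exists (enorm y), (normalize y); split; rewrite ?scale_normalize ?enorm_ge0//.
split; first exact: enorm_normalize.
exists (fun k => (tx k).2); split.
- by move=> k; have [_ ? /eqP ? _ _] := txP k.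
- by apply: small => k; have [] := txP k.
- rewrite (_ : (fun i => _) = fun i => normalize ((tx i).1 *: (tx i).2)); last first.
    by apply/funext => k; rewrite normalizeZ//; have [] := txP k.
  apply: normalize_cvg => //; apply/subr_cvg0.
  by apply: small => k; have [] := txP k.
Unshelve. all: by end_near.
Qed.

(** * Blow-up of a Lipschitz germ *)

(** The Lipschitz condition for the sup norm, to which the general lemmas on
    convergence and compactness apply; the two norms being equivalent, only the
    constant differs from the Euclidean condition. *)
Definition lipschitz_on (R : realType) n (L : R) (U : set 'rV[R]_n)
    (f : 'rV[R]_n -> 'rV[R]_n) : Prop :=
  forall x y, U x -> U y -> `|f x - f y| <= L * `|x - y|.

Lemma elipschitz_lipschitz_on (R : realType) n (U : set 'rV[R]_n) f :
  elipschitz U f -> exists2 L, 0 < L & lipschitz_on L U f.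
Proof.
case=> L HL; exists ((`|L| + 1) * (n%:R + 1)).
  by rewrite mulr_gt0// ltr_wpDl.
move=> x y Ux Uy; apply: le_trans (norm_le_enorm _) _.
apply: le_trans (HL _ _ Ux Uy) _; rewrite -mulrA.
apply: (@le_trans _ _ ((`|L| + 1) * enorm (x - y))).
  by rewrite ler_wpM2r ?enorm_ge0// (le_trans (ler_norm L))// lerDl.
rewrite ler_wpM2l ?addr_ge0//; apply: le_trans (enorm_le_norm _) _.
by rewrite ler_wpM2r// lerDl.
Qed.

(** The image ultrafilter has a cluster point p in the compact set, and an
    ultrafilter that meets every neighbourhood of p contains them all. *)
Lemma ultra_cvg_compact (I : Type) (T : topologicalType) (F : set_system I)
    (u : I -> T) (K : set T) :
  UltraFilter F -> compact K -> F (u @^-1` K) -> exists p : T, u @ F --> p.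
Proof.
move=> UF cK FK; have [p [_ pclu]] := cK (u @ F) _ FK.
exists p => N Np; have [//|FN] := in_ultra_setVsetC (u @^-1` N) UF.
by have [q [nN /nN]] := pclu (~` N) _ FN Np.
Qed.

Definition blowup (R : realType) n (f : 'rV[R]_n -> 'rV[R]_n)
    (x : 'rV[R]_n) (m : nat) : 'rV[R]_n :=
  m.+1%:R *: f (m.+1%:R^-1 *: x).

Lemma shrink_cvg0 (R : realType) n (x : 'rV[R]_n) :
  (fun m : nat => (m.+1%:R^-1 : R) *: x) @ \oo --> (0 : 'rV[R]_n).
Proof. by rewrite -(scale0r x); apply: cvgZr_tmp; exact: cvg_harmonic. Qed.

Lemma near_shrink (R : realType) n (U : set 'rV[R]_n) (x : 'rV[R]_n) :
  nbhs (0 : 'rV[R]_n) U -> \forall m \near \oo, U (m.+1%:R^-1 *: x).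
Proof. by move=> U0; exact: shrink_cvg0 U0. Qed.

Lemma norm_scale_natSB (R : realType) n (x y : 'rV[R]_n) (m : nat) :
  `|m.+1%:R *: x - m.+1%:R *: y| = m.+1%:R * `|x - y|.
Proof. by rewrite -scalerBr normrZ ger0_norm. Qed.

Lemma blowup_lipschitz (R : realType) n (L : R) (U : set 'rV[R]_n) f x y m :
  lipschitz_on L U f -> U (m.+1%:R^-1 *: x) -> U (m.+1%:R^-1 *: y) ->
  `|blowup f x m - blowup f y m| <= L * `|x - y|.
Proof.
move=> Lf Ux Uy; rewrite norm_scale_natSB.
apply: (le_trans (ler_wpM2l (ler0n _ _) (Lf _ _ Ux Uy))).
by rewrite -scalerBr normrZ ger0_norm ?invr_ge0// mulrCA mulVKf.
Qed.

Section BlowupLimit.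
Context (R : realType) (n : nat) (F : set_system nat).
Context {UF : UltraFilter F} (Foo : \oo `<=` F).
Implicit Types (f g : 'rV[R]_n -> 'rV[R]_n) (U : set 'rV[R]_n).

(** A directional derivative of f at 0 along F. Its value may depend on F, as a
    Lipschitz germ need not be differentiable in any direction. *)
Definition blowup_lim f (x : 'rV[R]_n) : 'rV[R]_n := lim (blowup f x @ F).

Lemma blowup_cvg L U f x :
  lipschitz_on L U f -> nbhs (0 : 'rV[R]_n) U -> f 0 = 0 ->
  blowup f x @ F --> blowup_lim f x.
Proof.
move=> Lf U0 f0.
have : exists p : 'rV[R]_n, blowup f x @ F --> p.
  apply: (@ultra_cvg_compact _ _ _ _ (closed_ball_ Num.norm 0 (L * `|x|))).
    apply: bounded_closed_compact; last exact: closed_closed_ball_.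
    exists (L * `|x|); split; rewrite ?num_real// => M LM y /=.
    by rewrite /closed_ball_/= sub0r normrN => /le_trans; apply; exact: ltW.
  have blowup0 m : blowup f 0 m = 0 by rewrite /blowup scaler0 f0 scaler0.
  apply: Foo; near=> m.
  rewrite /= /closed_ball_/= distrC -(blowup0 m) -[x in leRHS]subr0.
  apply: blowup_lipschitz Lf _ _; near: m; exact: near_shrink.
by case=> p pp; apply/cvg_ex; exists p.
Unshelve. all: by end_near.
Qed.

Lemma blowup_lim_lipschitz L U f :
  lipschitz_on L U f -> nbhs (0 : 'rV[R]_n) U -> f 0 = 0 ->
  lipschitz_on L setT (blowup_lim f).
Proof.
move=> Lf U0 f0 x y _ _.
have cvg_f z : blowup f z @ F --> blowup_lim f z := blowup_cvg Lf U0 f0.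
apply: (cvgr_to_le (cvg_norm (cvgB (cvg_f x) (cvg_f y)))).
apply: Foo; near=> m; apply: blowup_lipschitz Lf _ _; near: m; exact: near_shrink.
Unshelve. all: by end_near.
Qed.

(** The m-th blow-up of g sends that of f at x back to x exactly, once m is
    large. The blow-ups of g share the Lipschitz constant M, so evaluating them
    at the limit instead changes the value by an amount that vanishes along F. *)
Lemma blowup_limK L M U V f g :
  lipschitz_on L U f -> lipschitz_on M V g ->
  nbhs (0 : 'rV[R]_n) U -> nbhs (0 : 'rV[R]_n) V ->
  f 0 = 0 -> g 0 = 0 -> (forall x, U x -> V (f x) /\ g (f x) = x) ->
  cancel (blowup_lim f) (blowup_lim g).
Proof.
move=> Lf Mg U0 V0 f0 g0 fK x.
set y := blowup_lim f x.
have cx : blowup f x @ F --> y := blowup_cvg Lf U0 f0.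
apply: (@cvg_unique _ (@norm_hausdorff _ _) (blowup g y @ F)).
  exact: blowup_cvg Mg V0 g0.
apply/subr_cvg0/norm_cvg0P.
have : (fun m => M * `|y - blowup f x m|) @ F --> (0 : R).
  rewrite -(mulr0 M); apply: cvgMl_tmp.
  have := cvg_norm (cvgB (cvg_cst y) cx); rewrite subrr normr0; exact.
apply: squeeze_cvgr; last exact: cvg_cst.
apply: Foo; near=> m; rewrite normr_ge0/=.
have Ux : U (m.+1%:R^-1 *: x) by near: m; exact: near_shrink.
have Vy : V (m.+1%:R^-1 *: y) by near: m; exact: near_shrink.
have [Vfx gfx] := fK _ Ux.
have E : m.+1%:R^-1 *: blowup f x m = f (m.+1%:R^-1 *: x).
  by rewrite /blowup scalerA mulVf// scale1r.
have -> : blowup g y m - x = blowup g y m - blowup g (blowup f x m) m.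
  by rewrite /blowup E gfx scalerA divff// scale1r.
by apply: blowup_lipschitz Mg Vy _; rewrite E.
Unshelve. all: by end_near.
Qed.

Lemma blowup_lim0 f : f 0 = 0 -> blowup_lim f 0 = 0.
Proof.
move=> f0; rewrite /blowup_lim (_ : blowup f 0 = fun=> 0); last first.
  by apply/funext => m; rewrite /blowup scaler0 f0 scaler0.
exact: lim_cst.
Qed.

(** The ray through a need not meet A. The property (SSP) replaces its points
    t a / (m + 1) by points of A at distance o(1 / (m + 1)), a distance which
    stays negligible after applying f and multiplying by m + 1. *)
Lemma blowup_lim_direction L U f A a (t : R) :
  lipschitz_on L U f -> nbhs (0 : 'rV[R]_n) U -> f 0 = 0 -> 0 < L -> ssp A ->
  direction_set A a -> 0 < t -> blowup_lim f (t *: a) != 0 ->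
  tangent_cone (germ_image U f A) (blowup_lim f (t *: a)).
Proof.
move=> Lf U0 f0 L0 sspA Da t0 y0.
pose x : 'rV[R]_n := t *: a; rewrite -/x in y0 *.
set y := blowup_lim f x in y0 *.
have ea : enorm a = 1 by case: Da.
have ex : enorm x = t by rewrite enormZ ea mulr1 gtr0_norm.
have x0 : x != 0 by rewrite -enorm_gt0 ex.
pose u m : 'rV[R]_n := m.+1%:R^-1 *: x.
have uE m : enorm (u m) = m.+1%:R^-1 * t.
  by rewrite enormZ ger0_norm ?ex// invr_ge0.
have [||| b bA bu] := sspA u.
- by move=> m; rewrite scaler_eq0 negb_or x0 invr_eq0 pnatr_eq0.
- exact: shrink_cvg0.
- exists a => //; rewrite (_ : (fun m => _) = fun=> a); first exact: cvg_cst.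
  apply/funext => m; rewrite !normalizeZ// ?invr_gt0//.
  by rewrite /normalize ea invr1 scale1r.
(* the norm of u m is t / (m + 1), so the relative error in the selection
   property is, up to the factor t, the error rescaled by m + 1 *)
have near_b (e : R) : 0 < e -> \forall m \near \oo, m.+1%:R * `|u m - b m| < e.
  move=> e0; have e1 : 0 < e / t by rewrite divr_gt0.
  move/cvgr0Pnorm_lt: bu => /(_ _ e1); apply: filterS => m.
  rewrite uE ger0_norm ?divr_ge0 ?mulr_ge0 ?enorm_ge0 ?invr_ge0 ?(ltW t0)//.
  rewrite invfM invrK mulrA ltr_pM2r ?invr_gt0// mulrC; apply: le_lt_trans.
  by rewrite ler_wpM2l// norm_le_enorm.
apply: tangent_cone_approx => // e e0.
have e2 : 0 < e / 2 by rewrite divr_gt0.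
have e1 : 0 < e / 2 / L by rewrite divr_gt0.
have e3 : 0 < e / L by rewrite divr_gt0.
have b0 : b @ \oo --> (0 : 'rV[R]_n).
  rewrite (_ : b = fun m => u m - (u m - b m)); last first.
    by apply/funext => m; rewrite subKr.
  rewrite -[0]subr0; apply: cvgB; first exact: shrink_cvg0.
  apply/cvgr0Pnorm_lt => d d0; move: (near_b _ d0); apply: filterS => m.
  by apply: le_lt_trans; rewrite ler_peMl// ler1n.
have : \forall m \near F, [/\ U (u m), U (b m), `|b m| < e / L,
    m.+1%:R * `|u m - b m| < e / 2 / L & `|y - blowup f x m| < e / 2].
  near=> m; split; near: m.
  - by apply: Foo; exact: near_shrink.
  - by apply: Foo; exact: b0 U0.
  - by apply: Foo; move/cvgr0Pnorm_lt: b0; exact.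
  - by apply: Foo; exact: near_b.
  - have cy : blowup f x @ F --> y := blowup_cvg Lf U0 f0.
    by move/cvgrPdist_lt: cy; exact.
case/filter_ex => m [Uu Ub be ube ye].
exists m.+1%:R, (f (b m)); split=> //.
- by exists (b m).
- rewrite -[f _]subr0 -f0; apply: (le_lt_trans (Lf _ _ Ub (nbhs_singleton U0))).
  by rewrite subr0 mulrC -ltr_pdivlMr.
- rewrite distrC; apply: (le_lt_trans (ler_distD (blowup f x m) _ _)).
  rewrite [ltRHS]splitr ltrD//.
  rewrite norm_scale_natSB.
  apply: (le_lt_trans (ler_wpM2l (ler0n _ _) (Lf _ _ Uu Ub))).
  by rewrite mulrCA mulrC -ltr_pdivlMr.
Unshelve. all: by end_near.
Qed.

(** The vertex 0 needs a separate argument: it belongs to a tangent cone only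
    if there is a direction, and the image of a direction of A provides one. *)
Lemma blowup_lim_tangent_cone L U f A :
  lipschitz_on L U f -> nbhs (0 : 'rV[R]_n) U -> f 0 = 0 -> 0 < L ->
  injective (blowup_lim f) -> ssp A ->
  blowup_lim f @` tangent_cone A `<=` tangent_cone (germ_image U f A).
Proof.
move=> Lf U0 f0 L0 finj sspA _ [_ [t [a [t0 Da ->]]] <-].
have lim_neq0 z : z != 0 -> blowup_lim f z != 0.
  by apply: contra_neq => z0; apply: finj; rewrite z0 blowup_lim0.
have a0 : a != 0 by rewrite -enorm_gt0; case: Da => ->.
have [t_gt0|] := ltP 0 t.
  apply: (blowup_lim_direction Lf U0 f0 L0 sspA Da t_gt0).
  by apply: lim_neq0; rewrite scaler_eq0 negb_or a0 andbT lt0r_neq0.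
move=> t_le0; rewrite (_ : t = 0) ?scale0r ?blowup_lim0//; last exact/le_anti/andP.
have := blowup_lim_direction Lf U0 f0 L0 sspA Da ltr01.
rewrite scale1r lim_neq0// => /(_ isT)[s [c [_ Dc _]]].
by exists 0, c; rewrite scale0r.
Qed.

End BlowupLimit.

(** * Invariance of dimension *)

Lemma lipschitz_on_enorm (R : realType) n (L : R) (U : set 'rV[R]_n) f :
  0 < L -> lipschitz_on L U f -> exists2 K, 0 < K &
    forall x y, U x -> U y -> enorm (f x - f y) <= K * enorm (x - y).
Proof.
move=> L0 Lf; exists ((n%:R + 1) * L); first by rewrite mulr_gt0// ltr_wpDl.
move=> x y Ux Uy; apply: le_trans (enorm_le_norm _) _; rewrite -mulrA.
apply: (@le_trans _ _ (n%:R * (L * enorm (x - y)))).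
  rewrite ler_wpM2l//; apply: le_trans (Lf _ _ Ux Uy) _.
  by rewrite ler_wpM2l ?(ltW L0)// norm_le_enorm.
by rewrite ler_wpM2r ?mulr_ge0 ?enorm_ge0 ?(ltW L0)// lerDl.
Qed.

Lemma lipschitz_on_continuous (R : realType) n (L : R)
    (f : 'rV[R]_n -> 'rV[R]_n) :
  0 < L -> lipschitz_on L setT f -> continuous f.
Proof.
move=> L0 Lf x; apply/(@cvgrPdist_lt _ _ _ (nbhs x)) => e e0.
have eL : 0 < e / L by rewrite divr_gt0.
apply: filterS (nbhsx_ballx x _ eL) => y; rewrite mx_norm_ball /ball_/= => xy.
by apply: (le_lt_trans (Lf x y I I)); rewrite mulrC -ltr_pdivlMr.
Qed.

(** Turns images by a bijection into preimages, which commute with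
    intersections and keep open sets open. *)
Lemma image_cancel (S T : Type) (f : S -> T) (g : T -> S) (X : set S) :
  cancel f g -> cancel g f -> f @` X = g @^-1` X.
Proof.
move=> fK gK; apply/seteqP; split=> [_ [x Xx <-]|y Xgy]; first by rewrite /= fK.
by exists (g y).
Qed.

Section CoveringInvariance.
Context (S T : topologicalType) (f : S -> T) (g : T -> S).
Hypotheses (fc : continuous f) (gc : continuous g).
Hypotheses (fK : cancel f g) (gK : cancel g f).

Lemma rel_open_cover_image (X : set S) C :
  rel_open_cover X C -> rel_open_cover (f @` X) [set f @` W | W in C].
Proof.
case=> Copen Ccov; split.
  move=> _ [W CW <-]; have [G oG ->] := Copen _ CW.
  exists (g @^-1` G); first by apply: open_comp => // x _; exact: gc.
  by rewrite !(image_cancel _ fK gK) preimage_setI.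
rewrite -Ccov; apply/seteqP; split=> [y [_ [W CW <-] [x Wx <-]]|_ [x [W CW Wx] <-]].
  by exists x => //; exists W.
by exists (f @` W); [exists W|exists x].
Qed.

Lemma preimage_image_cancel (W : set S) : f @^-1` (f @` W) = W.
Proof.
rewrite (image_cancel _ fK gK) -comp_preimage.
by rewrite (_ : g \o f = id)//; apply/funext.
Qed.

Lemma order_le_image C k : order_le C k -> order_le [set f @` W | W in C] k.
Proof.
move=> oC F Finj FC.
have FE i : C (f @^-1` F i).
  by have [W CW <-] := FC i; rewrite preimage_image_cancel.
have Fim i : F i = f @` (f @^-1` F i).
  by have [W _ <-] := FC i; rewrite preimage_image_cancel.
have inj : injective (fun i => f @^-1` F i).
  by move=> i j ij; apply: Finj; rewrite Fim ij -Fim.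
(* a common point y of the F i gives the common point g y of the preimages *)
rewrite -subset0 => y Fy; have := oC _ inj FE; rewrite -subset0; apply.
by move=> i _ /=; instantiate (1 := g y); rewrite gK; exact: Fy.
Qed.
End CoveringInvariance.

Lemma covering_order_le_image (S T : topologicalType) (f : S -> T) (g : T -> S)
    (X : set S) k :
  continuous f -> continuous g -> cancel f g -> cancel g f ->
  covering_order_le X k -> covering_order_le (f @` X) k.
Proof.
move=> fc gc fK gK Xk C /(rel_open_cover_image fc gK fK).
rewrite [g @` _](image_cancel _ gK fK) (preimage_image_cancel fK gK).
case/Xk => C' [C'cov C'ref C'ord].
exists [set f @` W | W in C']; split.
- exact: rel_open_cover_image.
- move=> _ [W C'W <-]; have [_ [W' CW' <-] WW'] := C'ref _ C'W.
  exists W' => // _ [x Wx <-]; have [y W'y <-] := WW' _ Wx.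
  by rewrite gK.
- exact: order_le_image.
Qed.

Lemma covering_dim_image (R : realType) (S T : topologicalType) (f : S -> T)
    (g : T -> S) (X : set S) :
  continuous f -> continuous g -> cancel f g -> cancel g f ->
  covering_dim R (f @` X) = covering_dim R X.
Proof.
move=> fc gc fK gK; rewrite /covering_dim.
suff -> : covering_order_le (f @` X) = covering_order_le X by [].
apply/seteqP; split=> k; last exact: covering_order_le_image.
move/(covering_order_le_image gc fc gK fK).
by rewrite (image_cancel _ gK fK) (preimage_image_cancel fK gK).
Qed.

Section HausdorffInvariance.
Context (R : realType) (n : nat) (f : 'rV[R]_n -> 'rV[R]_n) (K : R).
Hypotheses (K0 : 0 < K)
  (fK : forall x y, enorm (f x - f y) <= K * enorm (x - y)).
Local Open Scope ereal_scope.

Lemma diam_ge0 (X : set 'rV[R]_n) : 0 <= diam X.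
Proof. by apply: ereal_sup_ubound; left. Qed.

Lemma diam_image (X : set 'rV[R]_n) : diam (f @` X) <= K%:E * diam X.
Proof.
apply: ge_ereal_sup => _ [->|[_ [x Xx <-] [_ [y Xy <-] <-]]].
  by rewrite mule_ge0 ?diam_ge0// lee_fin ltW.
apply: (@le_trans _ _ (K * enorm (x - y))%:E); first by rewrite lee_fin.
rewrite EFinM; apply: lee_wpmul2l; first by rewrite lee_fin ltW.
apply: ereal_sup_ubound; right.
by exists x => //; exists y.
Qed.

Lemma hausdorff_pre_ge0 s delta (X : set 'rV[R]_n) : 0 <= hausdorff_pre s delta X.
Proof.
apply: le_ereal_inf_tmp => _ [F _ <-]; apply: nneseries_ge0 => k _ _.
exact: poweR_ge0.
Qed.

(** The image of a cover by pieces of diameter at most delta covers the image,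
    with each diameter multiplied by at most K. *)
Lemma hausdorff_pre_image s delta (X : set 'rV[R]_n) : (0 < s)%R ->
  hausdorff_pre s (K * delta)%R (f @` X) <= (K `^ s)%:E * hausdorff_pre s delta X.
Proof.
move=> s0; have Ks0 : (0 < K `^ s)%R by rewrite powR_gt0.
rewrite -lee_pdivrMl//; apply: le_ereal_inf_tmp => _ [F [XF Fd] <-].
rewrite lee_pdivrMl// -nneseriesZl; last by move=> k _; exact: poweR_ge0.
apply: (@le_trans _ _ (\sum_(0 <= k <oo) diam (f @` F k) `^ s)).
  apply: ereal_inf_lbound; exists (fun k => f @` F k) => //; split.
    by rewrite -image_bigcup; exact: image_subset.
  move=> k; apply: le_trans (diam_image _) _.
  by rewrite EFinM; apply: lee_wpmul2l => //; rewrite lee_fin ltW.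
apply: lee_nneseries => k *; first exact: poweR_ge0.
rewrite -poweR_EFin -poweRM ?diam_ge0 ?lee_fin ?(ltW K0)//.
apply: gt0_ler_poweR; rewrite ?(ltW s0) ?in_itv/= ?diam_ge0 ?leey ?diam_image//.
by rewrite mule_ge0 ?diam_ge0// lee_fin ltW.
Qed.

Lemma hausdorff_measure_ge0 s (X : set 'rV[R]_n) : 0 <= hausdorff_measure s X.
Proof.
apply: (@le_trans _ _ (hausdorff_pre s 1 X)); first exact: hausdorff_pre_ge0.
by apply: ereal_sup_ubound; exists 1%R => //=; exact: ltr01.
Qed.

Lemma hausdorff_measure_image_eq0 s (X : set 'rV[R]_n) : (0 < s)%R ->
  hausdorff_measure s X = 0 -> hausdorff_measure s (f @` X) = 0.
Proof.
move=> s0 X0; apply/le_anti; rewrite hausdorff_measure_ge0 andbT.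
apply: ge_ereal_sup => _ [d d0 <-].
rewrite (_ : d = K * (d / K))%R; last by rewrite mulrC divfK// gt_eqF.
apply: le_trans (hausdorff_pre_image _ _ s0) _.
suff : hausdorff_pre s (d / K) X <= 0.
  by move=> dX; rewrite mule_ge0_le0// lee_fin powR_ge0.
by rewrite -X0; apply: ereal_sup_ubound; exists (d / K)%R => //=; exact: divr_gt0.
Qed.

Lemma hausdorff_dim_image_le (X : set 'rV[R]_n) :
  hausdorff_dim (f @` X) <= hausdorff_dim X.
Proof.
apply: ereal_inf_le_tmp => _ [s [s0 sX] <-]; exists s => //; split=> //.
exact: hausdorff_measure_image_eq0.
Qed.

End HausdorffInvariance.

Lemma dimension_image (R : realType) n d (L M : R) (f g : 'rV[R]_n -> 'rV[R]_n)
    (X : set 'rV[R]_n) :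
  0 < L -> 0 < M -> lipschitz_on L setT f -> lipschitz_on M setT g ->
  cancel f g -> cancel g f -> dimension d (f @` X) = dimension d X.
Proof.
move=> L0 M0 Lf Mg fK gK; case: d => /=.
  apply: covering_dim_image fK gK; last exact: lipschitz_on_continuous M0 Mg.
  exact: lipschitz_on_continuous L0 Lf.
have [K K0 fe] := lipschitz_on_enorm L0 Lf.
have [N N0 ge] := lipschitz_on_enorm M0 Mg.
apply/le_anti/andP; split.
  by apply: hausdorff_dim_image_le K0 _ _ => x y; exact: fe.
rewrite -{1}(preimage_image_cancel fK gK X) -(image_cancel _ gK fK).
by apply: hausdorff_dim_image_le N0 _ _ => x y; exact: ge.
Qed.

(** * Tangent cones and transversality of images of germs *)

Lemma tangent_cone_mono (R : realType) n (S T : set 'rV[R]_n) :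
  S `<=` T -> tangent_cone S `<=` tangent_cone T.
Proof.
move=> ST _ [t [a [t0 [a1 [x [xS x0 xa]]] ->]]]; exists t, a; split=> //.
split=> //; exists x; split=> // i; have [Sx nx] := xS i.
by split=> //; exact: ST.
Qed.

(** The map phi is chosen before A, which lets it be shared by two germs and
    hence by the intersection of their tangent cones. The property (SSP) of A
    gives one inclusion; that of the image gives the other through psi. *)
Lemma bilipschitz_germ_tangent (R : realType) n (U V : set 'rV[R]_n) h :
  bilipschitz_germ U V h ->
  exists phi psi : 'rV[R]_n -> 'rV[R]_n,
    [/\ cancel phi psi, cancel psi phi,
        (exists2 L, 0 < L & lipschitz_on L setT phi),
        (exists2 M, 0 < M & lipschitz_on M setT psi) &
        forall A, ssp A -> ssp (germ_image U h A) ->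
          tangent_cone (germ_image U h A) = phi @` tangent_cone A].
Proof.
case=> -[Uo U0] [Vo V0] h0 [g [hK gK /elipschitz_lipschitz_on[L L0 Lh]
  /elipschitz_lipschitz_on[M M0 Mg]]].
have [F [UF Foo]] := ultraFilterLemma (eventually_filter : ProperFilter \oo).
have nU : nbhs (0 : 'rV[R]_n) U by exact: open_nbhs_nbhs.
have nV : nbhs (0 : 'rV[R]_n) V by exact: open_nbhs_nbhs.
have g0 : g 0 = 0 by have [_] := hK _ U0; rewrite h0.
have phiK : cancel (blowup_lim F h) (blowup_lim F g).
  exact: (blowup_limK Foo Lh Mg nU nV h0 g0 hK).
have psiK : cancel (blowup_lim F g) (blowup_lim F h).
  exact: (blowup_limK Foo Mg Lh nV nU g0 h0 gK).
exists (blowup_lim F h), (blowup_lim F g); split=> //.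
- by exists L => //; exact: (blowup_lim_lipschitz Foo Lh nU h0).
- by exists M => //; exact: (blowup_lim_lipschitz Foo Mg nV g0).
move=> A sspA ssphA; apply/seteqP; split.
  have gA : germ_image V g (germ_image U h A) `<=` A.
    by move=> _ [_ [[x [Ax Ux] <-] _] <-]; have [_ ->] := hK _ Ux.
  have := blowup_lim_tangent_cone Foo Mg nV g0 M0 (can_inj psiK) ssphA.
  move=> sub y hAy; exists (blowup_lim F g y) => //.
  by apply: tangent_cone_mono gA _ _; apply: sub; exists y.
move=> _ [x Ax <-].
apply: (blowup_lim_tangent_cone Foo Lh nU h0 L0 (can_inj phiK) sspA).
by exists x.
Qed.

Unset Implicit Arguments.

Theorem corollary3p13 (R : realType) (n : nat) (d : dimension_notion)
    (A B U V : set 'rV[R]_n) (h : 'rV[R]_n -> 'rV[R]_n)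
    (hA0 : closure A (0 : 'rV[R]_n)) (hB0 : closure B (0 : 'rV[R]_n))
    (hh : bilipschitz_germ U V h)
    (sspA : ssp A) (sspB : ssp B)
    (ssphA : ssp (germ_image U h A)) (ssphB : ssp (germ_image U h B)) :
  transverse d A B <-> transverse d (germ_image U h A) (germ_image U h B).
Proof.
have [phi [psi [phiK psiK [L L0 Lphi] [M M0 Mpsi] phiLD]]] :=
  bilipschitz_germ_tangent hh.
have imI (X Y : set 'rV[R]_n) : phi @` X `&` phi @` Y = phi @` (X `&` Y).
  by rewrite !(image_cancel _ phiK psiK) preimage_setI.
rewrite /transverse !phiLD// imI.
by rewrite !(dimension_image d _ L0 M0 Lphi Mpsi phiK psiK).
Qed.
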